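(* Let $T \in \mathcal{B}_{A}(\mathcal{H})$. Then: (i) for every $\alpha\in[0,1]$, $$\|T\|_{A_\alpha}^2 \leq \left\|(1-\alpha) T^{\sharp_A}T+ \alpha TT^{\sharp_A}\right\|_{A};$$ (ii) $$w_A^2(T) \leq \min_{\alpha\in[0,1]} \left\| \alpha T^{\sharp_A}T+(1-\alpha)TT^{\sharp_A}\right\|_{A}.$$
   Context: $\mathcal{H}$ is a complex Hilbert space with inner product $\langle\cdot,\cdot\rangle$, $\mathcal{B}(\mathcal{H})$ is the algebra of bounded linear operators on $\mathcal{H}$, and $A\in\mathcal{B}(\mathcal{H})$ is a fixed positive operator (self-adjoint with $\langle Ax,x\rangle\ge 0$ for all $x\in\mathcal{H}$). Put $\langle x,y\rangle_A=\langle Ax,y\rangle$ and $\|x\|_A=\sqrt{\langle x,x\rangle_A}=\|A^{1/2}x\|$. $R(\cdot)$ denotes range. Let $\mathcal{B}_A(\mathcal{H})=\{T\in\mathcal{B}(\mathcal{H}) : R(T^*A)\subseteq R(A)\}$, a subalgebra of $\mathcal{B}(\mathcal{H})$ whose elements $T$ are $A$-bounded (there is $c>0$ with $\|Tx\|_A\le c\|x\|_A$ for all $x\in\mathcal{H}$). For $T\in\mathcal{B}_A(\mathcal{H})$, $T^{\sharp_A}$ denotes the unique solution $X\in\mathcal{B}(\mathcal{H})$ of $AX=T^*A$ with $R(X)\subseteq\overline{R(A)}$; it again belongs to $\mathcal{B}_A(\mathcal{H})$. For an $A$-bounded operator $T$: - the $A$-operator semi-norm is $\|T\|_A=\sup\{\|Tx\|_A/\|x\|_A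 : x\in\overline{R(A)},\ x\ne 0\}$; - the $A$-numerical radius is $w_A(T)=\sup\{|\langle Tx,x\rangle_A| : x\in\mathcal{H},\ \|x\|_A=1\}$; - for $\alpha\in[0,1]$, $\|T\|_{A_\alpha}=\sup\left\{\sqrt{\alpha|\langle Tx,x\rangle_A|^2+(1-\alpha)\|Tx\|_A^2} : x\in\mathcal{H},\ \|x\|_A=1\right\}$. *)

(* Defs.v *)
From HB Require Import structures.
From mathcomp Require Import all_boot all_order all_algebra sesquilinear.
From mathcomp Require Import complex.
From mathcomp Require Import all_classical all_reals all_analysis.

Set Implicit Arguments.
Unset Strict Implicit.
Unset Printing Implicit Defensive.

Import Order.TTheory GRing.Theory Num.Theory.
Import numFieldNormedType.Exports.

Local Open Scope classical_set_scope.
Local Open Scope complex_scope.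
Local Open Scope ring_scope.

(* Conventions: [dot] is linear in its first argument and conjugate-linear in
   its second one; operators are plain functions [H -> H]. *)

(* [dot] turns the Banach space [H] into a Hilbert space. *)
Definition is_inner (R : realType) (H : completeNormedModType R[i])
    (dot : {dot H for Num.conj}) : Prop :=
  forall x, `|x| ^+ 2 = dot x x.

Definition bounded_operator (R : realType) (H : completeNormedModType R[i])
    (T : H -> H) : Prop :=
  linear T /\ exists c : R, forall x, `|T x| <= c%:C * `|x|.

Definition adjoint_pair (R : realType) (H : completeNormedModType R[i])
    (dot : {dot H for Num.conj}) (T S : H -> H) : Prop :=
  forall x y, dot (T x) y = dot x (S y).

(* [get] selects an element of the set, here its only one by the Riesz
   representation theorem. *)
Definition adjoint (R : realType) (H : completeNormedModType R[i])
    (dot : {dot H for Num.conj}) (T : H -> H) : H -> H :=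
  get [set S | bounded_operator S /\ adjoint_pair dot T S].

(* [0 <= z] in [R[i]] means that [z] is a nonnegative real. *)
Definition positive_operator (R : realType) (H : completeNormedModType R[i])
    (dot : {dot H for Num.conj}) (A : H -> H) : Prop :=
  [/\ bounded_operator A, adjoint_pair dot A A & forall x, 0 <= dot (A x) x].

Section SemiHilbertian.
Context (R : realType) (H : completeNormedModType R[i]).
Context (dot : {dot H for Num.conj}) (A : H -> H).
Implicit Types (T : H -> H) (x y : H) (a : R).

Definition innerA x y : R[i] := dot (A x) y.

(* [innerA x x] is a nonnegative real when [A] is positive. *)
Definition normA x : R := Num.sqrt (complex.Re (innerA x x)).

Definition in_BA T : Prop :=
  bounded_operator T /\ range (adjoint dot T \o A) `<=` range A.

(* For [T] in B_A(H), the set has exactly one element, by Douglas' theorem. *)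
Definition sharpA T : H -> H :=
  get [set X | [/\ bounded_operator X,
                   A \o X = adjoint dot T \o A &
                   range X `<=` closure (range A)]].

(* The suprema below are those of sets of reals bounded above when [T] is
   A-bounded. If A = 0 they are taken over the empty set and [sup] is 0. *)
Definition opnormA T : R :=
  sup [set normA (T x) / normA x | x in closure (range A) `\ 0].

Definition numradA T : R :=
  sup [set complex.Re `|innerA (T x) x| | x in [set x | normA x = 1]].

Definition normAalpha a T : R :=
  sup [set Num.sqrt (a * complex.Re `|innerA (T x) x| ^+ 2 +
                     (1 - a) * normA (T x) ^+ 2)
      | x in [set x | normA x = 1]].

End SemiHilbertian.

Definition is_minimum (R : realType) (E : set R) (m : R) : Prop :=
  E m /\ lbound E m.

(* Main.v *)
(* Write X for the A-adjoint of T.  The form <x, y>_A is a positive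
   semidefinite Hermitian form for which X is an adjoint of T, so for
   |x|_A = 1 Cauchy-Schwarz bounds |<Tx, x>_A| both by |Tx|_A and by |Xx|_A,
   while (1-a) |Tx|_A^2 + a |Xx|_A^2 = <((1-a) XT + a TX) x, x>_A is at most
   the A-operator seminorm of (1-a) XT + a TX.

   That seminorm is a supremum, which is only meaningful once XT and TX are
   known to be A-bounded: both are bounded and A-selfadjoint, and for such an S
   the sequence |S^n x|_A is log-convex and grows at most like |S|^n, so that
   |Sx|_A <= |S| |x|_A.  A-boundedness also makes the seminorm of
   a XT + (1-a) TX Lipschitz in a, hence the minimum over [0,1] is attained.

   X exists because T*A maps into R(A): one takes the preimage under A lying in
   the closure of R(A); since <Xx, Au> = <x, ATu>, uniform boundedness applied
   to the vectors ATu with |Au| <= 1 makes X bounded.  The existence of T*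
   rests on the Riesz representation theorem. *)
Require Import Defs.
From HB Require Import structures.
From mathcomp Require Import all_boot all_order all_algebra sesquilinear.
From mathcomp Require Import complex ring lra.
From mathcomp Require Import all_classical all_reals all_analysis.

Import Order.TTheory GRing.Theory Num.Theory.
Import numFieldNormedType.Exports.

Local Open Scope classical_set_scope.
Local Open Scope complex_scope.
Local Open Scope ring_scope.

Local Notation Re := complex.Re.
Local Notation modC z := (complex.Re `|z|).

(** * Real-valued modulus and real part of complex numbers *)

Section ComplexModulus.
Context {R : realType}.
Implicit Types (z w : R[i]) (a : R).

Lemma modCE z : `|z| = (modC z)%:C.
Proof. by rewrite RRe_real // normr_real. Qed.

Lemma modC_ge0 z : 0 <= modC z.
Proof. by rewrite -lecR -modCE; apply: normr_ge0. Qed.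

Lemma modCD z w : modC (z + w) <= modC z + modC w.
Proof. by rewrite -lecR rmorphD/= -!modCE ler_normD. Qed.

Lemma modCM z w : modC (z * w) = modC z * modC w.
Proof. by apply: complexI; rewrite rmorphM/= -!modCE normrM. Qed.

Lemma modC_conj z : modC (Num.conj z) = modC z.
Proof. by rewrite norm_conjC. Qed.

Lemma modC_real a : modC (a%:C) = `|a|.
Proof. by rewrite normc_def/= expr0n/= addr0 sqrtr_sqr. Qed.

Lemma modC_ge_Re z : Re z <= modC z.
Proof.
rewrite normc_def/= (le_trans (ler_norm _))// -sqrtr_sqr ler_wsqrtr//.
by rewrite lerDl sqr_ge0.
Qed.

Lemma modC_eq0 z : modC z = 0 -> z = 0.
Proof. by move=> z0; apply/normr0_eq0; rewrite modCE z0. Qed.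

Lemma ReD z w : Re (z + w) = Re z + Re w.
Proof. by case: z w => [? ?] [? ?]. Qed.

Lemma ReN z : Re (- z) = - Re z.
Proof. by case: z. Qed.

Lemma ReRM a z : Re (a%:C * z) = a * Re z.
Proof. by case: z => [? ?] /=; rewrite mul0r subr0. Qed.

Lemma mul_conjC z : z * Num.conj z = (modC z ^+ 2)%:C.
Proof. by rewrite -normCK rmorphXn/= -modCE. Qed.

Lemma Re_conj z : Re (Num.conj z) = Re z.
Proof. by case: z. Qed.

Lemma gt0C (a : R[i]) : 0 < a -> exists2 e : R, 0 < e & a = e%:C.
Proof.
move=> a0; exists (Re a); last by rewrite RRe_real// gtr0_real.
by move: a0; rewrite ltcE => /andP[].
Qed.

End ComplexModulus.

(** * Semi-inner products *)

(** Definiteness is left out so that [dot] and the possibly degenerate form [innerA dot A] are both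
    instances. *)
Definition semi_inner {R : realType} {H : lmodType R[i]} (B : H -> H -> R[i]) :=
  [/\ forall a x y z, B (a *: x + y) z = a * B x z + B y z,
      forall x y, B x y = Num.conj (B y x) & forall x, 0 <= B x x].

Definition snorm {R : realType} {H : lmodType R[i]} (B : H -> H -> R[i])
    (x : H) : R :=
  Num.sqrt (Re (B x x)).

Section SemiInner.
Context {R : realType} {H : lmodType R[i]} {B : H -> H -> R[i]}.
Hypothesis HB : semi_inner B.
Implicit Types (x y z : H) (a : R[i]).
Local Notation q := (snorm B).

Lemma siDl x y z : B (x + y) z = B x z + B y z.
Proof. by case: HB => + _ _; move/(_ 1 x y z); rewrite scale1r mul1r. Qed.

Lemma si0l z : B 0 z = 0.
Proof. by apply: (addrI (B 0 z)); rewrite -siDl !addr0. Qed.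

Lemma siZl a x z : B (a *: x) z = a * B x z.
Proof. by case: HB => + _ _; move/(_ a x 0 z); rewrite si0l !addr0. Qed.

Lemma siC x y : B x y = Num.conj (B y x). Proof. by case: HB. Qed.

Lemma siDr x y z : B x (y + z) = B x y + B x z.
Proof. by rewrite siC siDl rmorphD/= -!siC. Qed.

Lemma siZr a x z : B x (a *: z) = Num.conj a * B x z.
Proof. by rewrite siC siZl rmorphM/= -!siC. Qed.

Lemma si0r x : B x 0 = 0.
Proof. by rewrite siC si0l conjC0. Qed.

Lemma siNl x z : B (- x) z = - B x z.
Proof. by rewrite -scaleN1r siZl mulN1r. Qed.

Lemma siNr x z : B x (- z) = - B x z.
Proof. by rewrite siC siNl rmorphN/= -siC. Qed.

Lemma siBl x y z : B (x - y) z = B x z - B y z.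
Proof. by rewrite siDl siNl. Qed.

Lemma siBr x y z : B x (y - z) = B x y - B x z.
Proof. by rewrite siDr siNr. Qed.

Lemma snorm_ge0 x : 0 <= q x. Proof. exact: sqrtr_ge0. Qed.

Lemma Re_si_ge0 x : 0 <= Re (B x x).
Proof. by case: HB => _ _ /(_ x); rewrite lecE => /andP[]. Qed.

Lemma sqr_snorm x : q x ^+ 2 = Re (B x x).
Proof. by rewrite sqr_sqrtr// Re_si_ge0. Qed.

Lemma siE x : B x x = (q x ^+ 2)%:C.
Proof. by rewrite sqr_snorm RRe_real// ger0_real//; case: HB. Qed.

Lemma modC_siC x y : modC (B x y) = modC (B y x).
Proof. by rewrite siC modC_conj. Qed.

Lemma snormZ a x : q (a *: x) = modC a * q x.
Proof.
apply/(pexpIrn (n := 2)) => //.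
- by rewrite nnegrE snorm_ge0.
- by rewrite nnegrE mulr_ge0 ?snorm_ge0 ?modC_ge0.
apply: complexI; rewrite -siE siZl siZr siE mulrA mul_conjC exprMn.
by rewrite [RHS]rmorphM.
Qed.

Lemma snorm0 : q 0 = 0.
Proof. by rewrite /snorm si0l/= sqrtr0. Qed.

Lemma snormN x : q (- x) = q x.
Proof. by rewrite -scaleN1r snormZ normrN1/= mul1r. Qed.

Lemma sqr_snormD x y :
  q (x + y) ^+ 2 = q x ^+ 2 + 2 * Re (B x y) + q y ^+ 2.
Proof.
rewrite !sqr_snorm siDl !siDr !ReD -(Re_conj (B y x)) -siC.
by ring.
Qed.

Lemma snorm_parallelogram x y :
  q (x + y) ^+ 2 + q (x - y) ^+ 2 = 2 * q x ^+ 2 + 2 * q y ^+ 2.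
Proof. by rewrite !sqr_snormD snormN siNr ReN; ring. Qed.

(** The scalar [b] stays free: Cauchy-Schwarz and the orthogonality in [projection] both come from
    choosing it. *)
Lemma sqr_snorm_sub_proj x y (b : R) :
  q (x - (b%:C * B x y) *: y) ^+ 2 =
  q x ^+ 2 - 2 * b * modC (B x y) ^+ 2 + b ^+ 2 * modC (B x y) ^+ 2 * q y ^+ 2.
Proof.
rewrite sqr_snormD snormN snormZ modCM modC_real siNr siZr rmorphM/=.
have -> : Num.conj b%:C = b%:C by exact: conjc_real.
rewrite mulrAC -!mulrA mul_conjC ReN ReRM/= !exprMn.
by rewrite real_normK ?num_real//; ring.
Qed.

Lemma si_CauchySchwarz x y : modC (B x y) <= q x * q y.
Proof.
(* With this ordering [q y = 0] forces [q x = 0], and then [b = 1] leaves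
   [0 <= - 2 * modC (B x y) ^+ 2]. *)
wlog qy : x y / q x <= q y => [wlogH|].
  have [/wlogH//|/ltW/wlogH] := leP (q x) (q y).
  by rewrite modC_siC mulrC.
have q2 (b : R) := sqr_snorm_sub_proj x y b.
have q0 b : 0 <= q (x - (b%:C * B x y) *: y) ^+ 2 by exact: sqr_ge0.
have [y0|yN0] := eqVneq (q y) 0.
  have x0 : q x = 0 by apply/eqP; rewrite eq_le snorm_ge0 andbT -y0.
  have := q0 1; rewrite q2 x0 y0 => m0.
  have : modC (B x y) ^+ 2 <= 0 by lra.
  by rewrite real_exprn_even_le0 ?num_real//= => /eqP ->; rewrite mulr0.
have y0 : 0 < q y by rewrite lt_def yN0 snorm_ge0.
(* This [b] minimizes the expansion. *)
have := q0 (q y ^- 2); rewrite q2 => m0.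
rewrite -(ler_pXn2r (n := 2)) ?nnegrE ?mulr_ge0 ?snorm_ge0 ?modC_ge0//.
rewrite exprMn -ler_pdivrMr ?exprn_gt0//.
rewrite -subr_ge0; apply: le_trans m0 _.
by rewrite le_eqVlt; apply/orP; left; apply/eqP; field.
Qed.

Lemma snormD x y : q (x + y) <= q x + q y.
Proof.
rewrite -(ler_pXn2r (n := 2)) ?nnegrE ?addr_ge0 ?snorm_ge0//.
rewrite sqr_snormD.
have := le_trans (modC_ge_Re _) (si_CauchySchwarz x y).
nra.
Qed.

(* The log-convexity [q (S^k x)^2 <= q (S^(k-1) x) q (S^(k+1) x)] makes the
   ratio of consecutive terms nondecreasing, so a first ratio above [c] would
   contradict the growth bound [K c^k]. *)
Lemma snorm_sadj_le (S : H -> H) (K : H -> R) (c : R) : 0 < c ->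
  (forall x y, B (S x) y = B x (S y)) ->
  (forall x n, q (iter n S x) <= K x * c ^+ n) ->
  forall x, q (S x) <= c * q x.
Proof.
move=> c0 Ssadj Kc x.
pose a n := q (iter n S x).
have a0 n : 0 <= a n by exact: snorm_ge0.
have alog n : a n.+1 ^+ 2 <= a n * a n.+2.
  rewrite /a sqr_snorm /= -Ssadj mulrC.
  exact: le_trans (modC_ge_Re _) (si_CauchySchwarz _ _).
rewrite leNgt; apply/negP => ca.
(* If [q x = 0], log-convexity at 0 gives [q (S x) = 0], against [ca]. *)
have x0 : 0 < q x.
  rewrite lt_def snorm_ge0 andbT; apply: contraTN ca => /eqP qx0.
  have := alog 0%N; rewrite /a /= qx0 mul0r mulr0 -leNgt.
  by rewrite real_exprn_even_le0 ?num_real//= => /eqP ->.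
(* [t > 1] is the first ratio in units of [c]; since the ratios do not decrease,
   [a n >= (t * c) ^+ n * q x]. *)
pose t := q (S x) / q x / c.
have t1 : 1 < t by rewrite /t !ltr_pdivlMr// mul1r.
have ta n : t * c * a n <= a n.+1.
  elim: n => [|n ih]; first by rewrite /a /= /t !divfK ?gt_eqF.
  have [an0|anN0] := eqVneq (a n.+1) 0; first by rewrite an0 mulr0 a0.
  have an0 : 0 < a n.+1 by rewrite lt_def anN0 a0.
  rewrite -(ler_pM2l an0) mulrCA -expr2.
  apply: le_trans (ler_wpM2l _ (alog n)) _.
    by rewrite mulr_ge0 ?ltW// (lt_trans _ t1).
  by rewrite mulrA ler_wpM2r.
have tn n : (t * c) ^+ n * q x <= a n.
  elim: n => [|n ih]; first by rewrite expr0 mul1r.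
  apply: le_trans (ta n); rewrite exprS -mulrA ler_wpM2l// mulr_ge0 ?ltW//.
  by rewrite (lt_trans _ t1).
have tK n : t ^+ n * q x <= K x.
  rewrite -(ler_pM2r (exprn_gt0 n c0)) (le_trans _ (Kc x n))//.
  by rewrite mulrAC -exprMn tn.
(* Bernoulli's inequality: [t ^+ n] outgrows the constant [K x / q x]. *)
have bern n : 1 + (t - 1) * n%:R <= t ^+ n.
  elim: n => [|n ih]; first by rewrite mulr0 addr0 expr0.
  rewrite exprS -natr1; have : t * (1 + (t - 1) * n%:R) <= t * t ^+ n.
    by rewrite ler_wpM2l// ltW// (lt_trans _ t1).
  have := sqr_ge0 (t - 1); have := ler0n R n; nra.
have bd : K x / q x / (t - 1) < (Num.trunc (K x / q x / (t - 1))).+1%:R.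
  exact: truncnS_gt.
move: bd; rewrite ltNge => /negP; apply.
rewrite !ler_pdivlMr ?subr_gt0//.
apply: le_trans (tK (Num.trunc (K x / q x / (t - 1))).+1).
apply: ler_wpM2r; first exact: ltW.
by apply: le_trans (bern _); rewrite mulrC lerDr.
Qed.

End SemiInner.

(** * Suprema of sets of nonnegative reals, possibly empty *)

Section Sup.
Context {R : realType}.
Implicit Types (E : set R) (c : R).

(** The bound [0 <= c] covers the empty set, whose [sup] is 0. *)
Lemma sup_le_ge0 E c : 0 <= c -> ubound E c -> sup E <= c.
Proof.
move=> c0 Ec; have [->|/set0P E0] := eqVneq E set0; first by rewrite sup0.
exact: ge_sup.
Qed.

Lemma sup_ge0 E : (forall y, E y -> 0 <= y) -> 0 <= sup E.
Proof.
move=> E0; have [supE|/sup_out -> //] := pselect (has_sup E).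
have [[y Ey] Eb] := supE; apply: le_trans (E0 y Ey) _.
exact: ub_le_sup.
Qed.

Lemma sqr_sup_le E c : 0 <= c -> (forall y, E y -> 0 <= y) ->
  (forall y, E y -> y ^+ 2 <= c) -> sup E ^+ 2 <= c.
Proof.
move=> c0 E0 Ec; rewrite -(sqr_sqrtr c0).
rewrite ler_pXn2r ?nnegrE ?sup_ge0 ?sqrtr_ge0//.
apply: sup_le_ge0 => [|y Ey]; first exact: sqrtr_ge0.
by rewrite -(ger0_norm (E0 y Ey)) -sqrtr_sqr ler_wsqrtr// Ec.
Qed.

End Sup.

(** * Plain functions satisfying the linearity equation *)

Section LinearMap.
Context {R : realType} {U V : lmodType R[i]} {f : U -> V}.
Hypothesis fl : forall (a : R[i]) x y, f (a *: x + y) = a *: f x + f y.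

Lemma linmap0 : f 0 = 0.
Proof. by have := fl (-1) 0 0; rewrite scaleN1r oppr0 addr0 scaleN1r addNr. Qed.

Lemma linmapZ a x : f (a *: x) = a *: f x.
Proof. by rewrite -[a *: x]addr0 fl linmap0 addr0. Qed.

Lemma linmapD x y : f (x + y) = f x + f y.
Proof. by rewrite -{1}[x]scale1r fl scale1r. Qed.

Lemma linmapB x y : f (x - y) = f x - f y.
Proof. by rewrite linmapD -scaleN1r linmapZ scaleN1r. Qed.

End LinearMap.

(** * Orthogonal projections, Riesz representation and adjoints *)

Section Hilbert.
Context {R : realType} {H : completeNormedModType R[i]}.
Context {dot : {dot H for Num.conj}} (Hdot : is_inner dot).
Implicit Types (x y z u v : H) (M : set H) (e c : R).
Local Notation nr := (snorm dot).

Lemma semi_inner_dot : semi_inner dot.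
Proof.
split=> [a x y z|x y|x]; first by rewrite linearPl.
  by rewrite hermC expr0 mul1r.
by rewrite -Hdot exprn_ge0.
Qed.

Local Notation SD := semi_inner_dot.

Lemma normE x : `|x| = (nr x)%:C.
Proof.
apply/(pexpIrn (n := 2)) => //; first by rewrite nnegrE.
  by rewrite nnegrE ler0c; apply: snorm_ge0.
by rewrite Hdot (siE SD) rmorphXn.
Qed.

Lemma snorm_eq0 x : nr x = 0 -> x = 0.
Proof. by move=> x0; apply/normr0_eq0; rewrite normE x0. Qed.

(** Completeness restated with real tolerances, as the norm of [H] takes its values in [R[i]]. *)
Lemma hilbert_complete (u : nat -> H) :
  (forall e, 0 < e -> exists N, forall m n, (N <= m)%N -> (N <= n)%N ->
     nr (u m - u n) < e) ->
  exists l, forall e, 0 < e -> exists N, forall n, (N <= n)%N ->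
     nr (u n - l) < e.
Proof.
move=> cu.
have /cvg_ex[/= l ul] : cvg (u @ \oo).
  apply: cauchy_cvg; apply: cauchy_exP => _ /gt0C[e e0 ->].
  have [N uN] := cu e e0.
  exists (u N); exists N => // n /= Nn.
  by rewrite -ball_normE /= normE ltcR uN.
exists l => e e0.
have e0C : 0 < e%:C by rewrite ltcR.
move/cvgrPdist_lt: ul => /(_ _ e0C)[N _ uN]; exists N => n Nn.
by have := uN n Nn; rewrite /= distrC normE ltcR.
Qed.

Lemma closureP M x :
  closure M x <-> forall e, 0 < e -> exists2 m, M m & nr (x - m) < e.
Proof.
split=> [Mx e e0|Mx A /nbhs_ballP[_ /gt0C[e e0 ->] eA]].
  have [|m [Mm]] := Mx (ball x e%:C); first by apply: nbhsx_ballx; rewrite ltcR.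
  by rewrite -ball_normE /= normE ltcR; exists m.
have [m Mm xm] := Mx e e0; exists m; split => //; apply: eA.
by rewrite -ball_normE /= normE ltcR.
Qed.

Lemma modC_dot_le x y : modC (dot x y) <= nr x * nr y.
Proof. exact: (si_CauchySchwarz SD). Qed.

(** For [m] in [M] close to [p], [|p|^2 <= |<p, m>| + |p| |p - m|] is at most about [c |p|]. With
    [M = range A] this yields injectivity of [A] on the closure of its range and the boundedness of
    the A-adjoint. *)
Lemma closure_norm_le M p c : 0 <= c -> closure M p ->
  (forall m, M m -> modC (dot p m) <= c * nr m) -> nr p <= c.
Proof.
move=> c0 /closureP Mp pM.
rewrite leNgt; apply/negP => cp.
have p0 : 0 < nr p by exact: le_lt_trans cp.
(* With [r = |p - m|], the estimates give [|p|^2 <= c (|p| + r) + |p| r], which fails once [r] is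
   below this threshold. *)
have e0 : 0 < nr p * (nr p - c) / (c + nr p).
  by rewrite divr_gt0 ?mulr_gt0 ?subr_gt0// ltr_wpDl.
have [m Mm] := Mp _ e0; rewrite ltr_pdivlMr ?ltr_wpDl// => pm.
have h1 : nr p ^+ 2 <= modC (dot p m) + nr p * nr (p - m).
  rewrite -[leLHS]ger0_norm ?sqr_ge0// -modC_real -(siE SD).
  rewrite -{2}(subrK m p) (siDr SD) addrC.
  by apply: le_trans (modCD _ _) _; rewrite lerD2l modC_dot_le.
have h2 : nr m <= nr p + nr (p - m).
  rewrite -{1}(subKr p m) -(snormN SD (p - m)).
  exact: (snormD SD).
have := pM m Mm; nra.
Qed.

Definition subspace M :=
  M 0 /\ forall (a : R[i]) x y, M x -> M y -> M (a *: x + y).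

Lemma subspaceD M x y : subspace M -> M x -> M y -> M (x + y).
Proof. by move=> [_ sM] Mx My; have := sM 1 _ _ Mx My; rewrite scale1r. Qed.

Lemma subspaceZ M (a : R[i]) x : subspace M -> M x -> M (a *: x).
Proof. by move=> [M0 sM] Mx; have := sM a _ _ Mx M0; rewrite addr0. Qed.

Lemma closure_subspace M : subspace M -> subspace (closure M).
Proof.
move=> sM; split=> [|a x y /closureP Mx /closureP My].
  by apply: subset_closure; case: sM.
apply/closureP => e e0.
have a0 : 0 < modC a + 1 by rewrite ltr_wpDl ?modC_ge0.
have e2 : 0 < e / 2 by rewrite divr_gt0.
have [m Mm xm] := Mx (e / 2 / (modC a + 1)) (divr_gt0 e2 a0).
have [n Mn yn] := My (e / 2) e2.
exists (a *: m + n); first by case: sM => _; apply.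
rewrite opprD addrACA -scalerBr.
apply: le_lt_trans (snormD SD _ _) _; rewrite (snormZ SD).
move: xm; rewrite ltr_pdivlMr// => xm.
have := snorm_ge0 (B := dot) (x - m); nra.
Qed.

(* A minimizing sequence for the distance to [M] is Cauchy by the
   parallelogram law. *)
Lemma nearest_point M x : subspace M ->
  exists2 p, closure M p & forall m, M m -> nr (x - p) <= nr (x - p - m).
Proof.
move=> sM; have [M0 _] := sM.
pose D := [set nr (x - m) | m in M].
have D0 : D !=set0 by exists (nr (x - 0)), 0.
have lD : lbound D 0 by move=> _ [m _ <-]; exact: snorm_ge0.
pose d := inf D.
have d0 : 0 <= d by exact: lb_le_inf.
have dM m : M m -> d <= nr (x - m).
  by move=> Mm; apply: ge_inf; [exists 0|exists m].
have ex n : exists m, M m /\ nr (x - m) < d + n.+1%:R^-1.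
  have n0 : 0 < n.+1%:R^-1 :> R by rewrite invr_gt0.
  have D1 : has_inf D by split=> //; exists 0.
  have [_ [m Mm <-] xm] := inf_adherent n0 D1.
  by exists m.
have [u Pu] := choice ex.
(* The midpoint of [u m] and [u n] lies in [M], so with [i = 1/(N+1)] the parallelogram law bounds
   the left side by [4 (d + i)^2 - 4 d^2 = 8 d i + 4 i^2], and [i <= 1]. *)
have uu m n N : (N <= m)%N -> (N <= n)%N ->
    nr (u m - u n) ^+ 2 <= N.+1%:R^-1 * (8 * d + 4).
  move=> Nm Nn.
  have N1 k : (N <= k)%N -> nr (x - u k) <= d + N.+1%:R^-1.
    move=> Nk; apply: le_trans (ltW (Pu k).2) _.
    by rewrite lerD2l lef_pV2 ?posrE// ler_nat.
  have mid : d <= nr (x - 2^-1 *: (u m + u n)).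
    apply: dM; apply: subspaceZ => //.
    by apply: subspaceD => //; case: (Pu m) (Pu n) => ? _ [].
  have := snorm_parallelogram SD (x - u m) (x - u n).
  have -> : x - u m + (x - u n) = 2 *: (x - 2^-1 *: (u m + u n)).
    rewrite scalerBr scalerA mulfV ?pnatr_eq0// scale1r scaler_nat mulr2n.
    by rewrite opprD addrACA.
  have -> : x - u m - (x - u n) = - (u m - u n).
    by rewrite opprB [RHS]opprB addrC addrA subrK.
  rewrite (snormN SD) (snormZ SD) normr_nat.
  have -> : Re 2%:R = 2 :> R by rewrite -(rmorph_nat (real_complex R)).
  have := N1 _ Nm; have := N1 _ Nn.
  have i0 : 0 <= N.+1%:R^-1 :> R by rewrite invr_ge0.
  have i1 : N.+1%:R^-1 <= 1 :> R by rewrite invf_le1// ler1n.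
  move: (snorm_ge0 (B := dot) (x - u m)) (snorm_ge0 (B := dot) (x - u n)).
  move: mid i0 i1; set i := N.+1%:R^-1.
  set s := nr (x - _ *: _); set b := nr (x - u m); set b' := nr (x - u n).
  move=> ds i0 i1 b0 b'0 hb hb' eq2.
  have s2 : d ^+ 2 <= s ^+ 2 by rewrite ler_pXn2r// ?nnegrE// (le_trans d0).
  have b2 : b ^+ 2 <= (d + i) ^+ 2 by rewrite ler_pXn2r// ?nnegrE// addr_ge0.
  have b2' : b' ^+ 2 <= (d + i) ^+ 2 by rewrite ler_pXn2r// ?nnegrE// addr_ge0.
  have ii : i ^+ 2 <= i by rewrite expr2 ler_piMl.
  move: eq2; rewrite exprMn; nra.
have [|p up] := hilbert_complete u.
  move=> e e0.
  have e2 : 0 < e ^+ 2 / (8 * d + 4) by rewrite divr_gt0 ?exprn_gt0//; lra.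
  exists (Num.trunc (e ^+ 2 / (8 * d + 4))^-1) => m n Nm Nn.
  rewrite -(ltr_pXn2r (n := 2)) ?nnegrE ?snorm_ge0 ?ltW//.
  apply: le_lt_trans (uu _ _ _ Nm Nn) _.
  rewrite -ltr_pdivlMr; last lra.
  by rewrite -ltf_pV2 ?posrE// ?invr_gt0// invrK truncnS_gt.
have pd e : 0 < e -> nr (x - p) < d + e.
  move=> e0.
  have e2 : 0 < e / 2 by lra.
  have [N uN] := up _ e2.
  pose n := maxn N (Num.trunc (e / 2)^-1).
  have un := uN n (leq_maxl _ _).
  have dn : nr (x - u n) < d + e / 2.
    apply: lt_le_trans (Pu n).2 _; rewrite lerD2l -[leRHS]invrK.
    rewrite lef_pV2 ?posrE ?invr_gt0// ltW// (lt_le_trans (truncnS_gt _))//.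
    by rewrite ler_nat ltnS leq_maxr.
  have -> : x - p = (x - u n) + (u n - p) by rewrite addrA subrK.
  apply: le_lt_trans (snormD SD _ _) _; lra.
have cp : closure M p.
  apply/closureP => e e0; have [N uN] := up _ e0.
  exists (u N); first by case: (Pu N).
  by rewrite -(snormN SD) opprB uN.
exists p => // m Mm; apply: (@le_trans _ _ d).
  by apply/ler_addgt0Pr => e e0; exact/ltW/pd.
(* As [p] is only in the closure, [p + m] is compared with [k + m], which does lie in [M]. *)
apply/ler_addgt0Pr => e e0; have /closureP/(_ e e0)[k Mk pk] := cp.
apply: le_trans (dM (k + m) _) _; first exact: subspaceD.
have -> : x - (k + m) = (x - p - m) + (p - k).
  by rewrite opprD [LHS]addrA addrACA addrA [in RHS]addrAC subrK addrAC.
apply: le_trans (snormD SD _ _) _; lra.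
Qed.

(** Moving the nearest point [p] along [m] by [<x - p, m> / |m|^2] would lower the squared distance
    by [|<x - p, m>|^2 / |m|^2]. *)
Lemma projection M x : subspace M ->
  exists2 p, closure M p & forall m, M m -> dot (x - p) m = 0.
Proof.
move=> sM; have [p Mp xp] := nearest_point M x sM; exists p => // m Mm.
have [m0|mN0] := eqVneq (nr m) 0.
  by rewrite (snorm_eq0 _ m0) (si0r SD).
have m0 : 0 < nr m by rewrite lt_def mN0 snorm_ge0.
have := xp _ (subspaceZ _ ((nr m ^- 2)%:C * dot (x - p) m) _ sM Mm).
rewrite -(ler_pXn2r (n := 2)) ?nnegrE ?snorm_ge0//.
rewrite (sqr_snorm_sub_proj SD) => h.
have : modC (dot (x - p) m) ^+ 2 / nr m ^+ 2 <= 0.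
  have -> : modC (dot (x - p) m) ^+ 2 / nr m ^+ 2 =
    2 * nr m ^- 2 * modC (dot (x - p) m) ^+ 2 -
    (nr m ^- 2) ^+ 2 * modC (dot (x - p) m) ^+ 2 * nr m ^+ 2 by field.
  lra.
rewrite ler_pdivrMr ?exprn_gt0// mul0r real_exprn_even_le0 ?num_real//=.
by move=> /eqP; exact: modC_eq0.
Qed.

(** The representing vector is a multiple of [z = x0 - p], with [f x0 != 0] and [p] the projection
    of [x0] on the closure of the kernel. *)
Lemma riesz (f : H -> R[i]) c :
  (forall a x y, f (a *: x + y) = a * f x + f y) ->
  (forall x, modC (f x) <= c * nr x) ->
  exists y, forall x, f x = dot x y.
Proof.
move=> fl fc.
have f0 : f 0 = 0.
  have /eqP := fl 1 0 0; rewrite scale1r mul1r addr0 -subr_eq0 opprD addrA.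
  by rewrite subrr sub0r oppr_eq0 => /eqP.
have [[x0 fx0]|nf] := pselect (exists x, f x != 0); last first.
  exists 0 => x; rewrite (si0r SD); apply/eqP/negPn/negP => fx.
  by apply: nf; exists x.
have sM : subspace [set x | f x = 0].
  by split=> //= a x y fx fy; rewrite fl fx fy mulr0 addr0.
have [p /closureP Mp px] := projection _ x0 sM.
have c0 : 0 <= `|c| + 1 by rewrite addr_ge0.
have fc1 x : modC (f x) <= (`|c| + 1) * nr x.
  apply: le_trans (fc x) _; apply: ler_wpM2r; first exact: snorm_ge0.
  by rewrite (le_trans (ler_norm _))// lerDl.
have fB x y : f (x - y) = f x - f y.
  by rewrite addrC -scaleN1r fl mulN1r addrC.
(* The kernel is closed because [f] is bounded. *)
have fp : f p = 0.
  apply: modC_eq0; apply/eqP; rewrite eq_le modC_ge0 andbT.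
  apply/ler_addgt0Pr => e e0; rewrite add0r.
  have c1 : 0 < `|c| + 1 by rewrite ltr_wpDl.
  have [m /= fm pm] := Mp (e / (`|c| + 1)) (divr_gt0 e0 c1).
  have <- : f (p - m) = f p by rewrite fB fm subr0.
  apply: le_trans (fc1 _) _; rewrite mulrC -ler_pdivlMr//; exact: ltW.
set z := x0 - p in px.
have fz : f z = f x0 by rewrite fB fp subr0.
have zN0 : dot z z != 0.
  apply: contra fx0 => /eqP; rewrite (siE SD) -fz => z0.
  rewrite (snorm_eq0 z) ?f0//; apply/eqP; rewrite -sqrf_eq0.
  by apply/eqP; exact: complexI.
exists (Num.conj (f z / dot z z) *: z) => x.
rewrite (siZr SD) conjCK.
(* This vector lies in the kernel, to which [z] is orthogonal; solving for [f x] gives the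
   representation. *)
have : dot z (f z *: x - f x *: z) = 0.
  apply: px => /=; rewrite fB -[_ *: x]addr0 -[_ *: z]addr0 !fl f0 !addr0.
  by rewrite mulrC subrr.
move/(congr1 Num.conj); rewrite -(siC SD) (siBl SD) !(siZl SD) conjC0.
move/eqP; rewrite subr_eq0 => /eqP h.
by rewrite mulrAC h mulfK.
Qed.


Lemma dot_nondegenerate y z : (forall x, dot x y = dot x z) -> y = z.
Proof.
move=> yz; apply/eqP; rewrite -subr_eq0; apply/eqP/snorm_eq0/eqP.
rewrite -sqrf_eq0; apply/eqP; apply: complexI.
by rewrite -(siE SD) (siBr SD) yz subrr.
Qed.

Lemma bounded_operatorP (T : H -> H) : bounded_operator T <->
  (forall (a : R[i]) x y, T (a *: x + y) = a *: T x + T y) /\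
  exists2 c : R, 0 < c & forall x, nr (T x) <= c * nr x.
Proof.
split=> -[Tl Tc]; split=> //.
  have [c cT] := Tc; exists (`|c| + 1) => [|x]; first by rewrite ltr_wpDl.
  have := cT x; rewrite !normE -rmorphM lecR => /le_trans; apply.
  apply: ler_wpM2r; first exact: snorm_ge0.
  by rewrite (le_trans (ler_norm _))// lerDl.
by have [c _ cT] := Tc; exists c => x; rewrite !normE -rmorphM lecR.
Qed.

(** Riesz applied to [x |-> <T x, y>] gives [S y]; the bound comes from
    [|S y|^2 = <T (S y), y> <= c |S y| |y|]. *)
Lemma adjointP (T : H -> H) : bounded_operator T ->
  bounded_operator (adjoint dot T) /\ adjoint_pair dot T (adjoint dot T).
Proof.
move=> /bounded_operatorP[Tl [c c0 Tc]].
apply: (getPex (P := [set S | bounded_operator S /\ adjoint_pair dot T S])).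
have : forall y, exists z, forall x, dot (T x) y = dot x z.
  move=> y; apply: (riesz (fun x => dot (T x) y) (c * nr y)).
    by move=> a x z; rewrite Tl linearPl.
  move=> x; apply: le_trans (modC_dot_le _ _) _.
  by rewrite mulrAC ler_wpM2r// snorm_ge0.
move=> /choice[S ST]; exists S; split; last by move=> x y.
apply/bounded_operatorP; split=> [a x y|].
  apply: dot_nondegenerate => z.
  by rewrite -ST !(siDr SD) !(siZr SD) -!ST.
exists c => // y; have [->|yN0] := eqVneq (nr (S y)) 0.
  by apply: mulr_ge0; [exact: ltW|exact: snorm_ge0].
have y0 : 0 < nr (S y) by rewrite lt_def yN0 snorm_ge0.
rewrite -(ler_pM2l y0) -expr2 (sqr_snorm SD) -ST.
apply: le_trans (modC_ge_Re _) _; apply: le_trans (modC_dot_le _ _) _.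
by rewrite mulrA ler_wpM2r ?snorm_ge0// mulrC Tc.
Qed.

(** * Uniform boundedness *)

(* Gliding hump: moving by [3^-n] from [x_n] in the direction [± v_n] makes
   [|<x_(n+1), v_n>| >= 3^-n |v_n|], and the later moves undo at most half of
   this. *)
Lemma uniform_boundedness (V : set H) :
  (forall x, exists K : R, forall v, V v -> modC (dot x v) <= K) ->
  exists C : R, forall v, V v -> nr v <= C.
Proof.
move=> VK; apply: contrapT => nC.
have ex (n : nat) : exists v, V v /\ n%:R * 3 ^+ n < nr v.
  apply: contrapT => nv; apply: nC; exists (n%:R * 3 ^+ n) => v Vv.
  by rewrite leNgt; apply/negP => nvv; apply: nv; exists v.
have [v vP] := choice ex.
have i3 n : 0 < 3 ^- n :> R by rewrite invr_gt0 exprn_gt0.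
have v0 n : 0 < nr (v n).
  by apply: le_lt_trans (vP n).2; rewrite mulr_ge0// exprn_ge0.
have step n x : exists y, nr (y - x) <= 3 ^- n /\
    3 ^- n * nr (v n) <= modC (dot y (v n)).
  pose w := (3 ^- n / nr (v n))%:C *: v n.
  have nw : nr w = 3 ^- n.
    rewrite (snormZ SD) modC_real ger0_norm ?divfK ?gt_eqF//.
    by rewrite divr_ge0 ?ltW.
  have dw : dot w (v n) = (3 ^- n * nr (v n))%:C.
    rewrite (siZl SD) (siE SD) -[LHS]rmorphM; congr (_%:C).
    by field; rewrite gt_eqF//= gt_eqF// exprn_gt0.
  (* The two inner products differ by [2 <w, v n>], so one of them has modulus at least
     [<w, v n>]. *)
  have h : 2 * (3 ^- n * nr (v n)) <=
      modC (dot (x + w) (v n)) + modC (dot (x - w) (v n)).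
    have -> : 2 * (3 ^- n * nr (v n)) = modC (dot w (v n) + dot w (v n)).
      rewrite dw -rmorphD modC_real ger0_norm; first by ring.
      by rewrite addr_ge0// mulr_ge0// ltW.
    have -> : dot w (v n) + dot w (v n) =
        dot (x + w) (v n) + - dot (x - w) (v n).
      by rewrite (siBl SD) (siDl SD); ring.
    by apply: le_trans (modCD _ _) _; rewrite normrN.
  have [h1|h1] := leP (3 ^- n * nr (v n)) (modC (dot (x + w) (v n))).
    by exists (x + w); split=> //; rewrite addrAC subrr add0r nw.
  exists (x - w); split; first by rewrite addrAC subrr add0r (snormN SD) nw.
  lra.
have [g gP] := choice (fun nx : nat * H => step nx.1 nx.2).
pose fix u n := if n is k.+1 then g (k, u k) else 0.
have uS n : nr (u n.+1 - u n) <= 3 ^- n by case: (gP (n, u n)).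
have uv n : 3 ^- n * nr (v n) <= modC (dot (u n.+1) (v n)).
  by case: (gP (n, u n)).
(* The right side is the geometric sum of [3 ^- j] for [n <= j < n + k]. *)
have unk n k : nr (u (n + k)%N - u n) <= 3 / 2 * (3 ^- n - 3 ^- (n + k)).
  elim: k => [|k ih]; first by rewrite addn0 !subrr (snorm0 SD) mulr0.
  rewrite addnS -[_ - u n](subrKA (u (n + k)%N)).
  apply: le_trans (snormD SD _ _) _; apply: le_trans (lerD (uS _) ih) _.
  by rewrite exprS invfM; lra.
have unm n m : (n <= m)%N -> nr (u m - u n) <= 3 / 2 * 3 ^- n.
  move=> /subnKC <-; apply: le_trans (unk _ _) _.
  by have := i3 (n + (m - n))%N; lra.
have [|l ul] := hilbert_complete u.
  move=> e e0; pose N := Num.trunc (3 / e).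
  have Ne : 3 * 3 ^- N < e.
    rewrite ltr_pdivrMr ?exprn_gt0// mulrC -ltr_pdivrMr//.
    apply: lt_le_trans (truncnS_gt _) _.
    by rewrite -natrX ler_nat ltn_expl.
  exists N => m n Nm Nn.
  rewrite -[_ - u n](subrKA (u N)) -(opprB (u n)).
  apply: le_lt_trans (snormD SD _ _) _; rewrite (snormN SD).
  have := unm _ _ Nm; have := unm _ _ Nn; lra.
have lu n : nr (l - u n) <= 3 / 2 * 3 ^- n.
  apply/ler_addgt0Pr => e e0; have [N uN] := ul e e0.
  rewrite -[_ - u n](subrKA (u (maxn n N))).
  apply: le_trans (snormD SD _ _) _; rewrite addrC lerD//.
    by rewrite unm// leq_maxl.
  by rewrite -(snormN SD) opprB ltW// uN// leq_maxr.
have [K lK] := VK l.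
(* From [h1] and [h2], half of [3 ^- n * nr (v n)] is at most [K], while [3 ^- n * nr (v n)] exceeds
   [n > 2 * K]. *)
pose n := (Num.trunc (2 * K)).+1.
have nK : 2 * K < n%:R by exact: truncnS_gt.
have h1 : modC (dot (u n.+1) (v n)) <= K + modC (dot (u n.+1 - l) (v n)).
  rewrite (siBl SD) -{1}(subrK (dot l (v n)) (dot (u n.+1) (v n))).
  by apply: le_trans (modCD _ _) _; rewrite addrC lerD2r lK//; case: (vP n).
(* The tail after step [n + 1] is at most [3 / 2 * 3 ^- n.+1 = 1 / 2 * 3 ^- n]. *)
have h2 : modC (dot (u n.+1 - l) (v n)) <= 1 / 2 * 3 ^- n * nr (v n).
  apply: le_trans (modC_dot_le _ _) _; apply: ler_wpM2r; first exact: ltW.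
  rewrite -(snormN SD) opprB (le_trans (lu _))// exprS invfM.
  by have := i3 n; lra.
have h3 : n%:R < 3 ^- n * nr (v n).
  rewrite -ltr_pdivrMl// invrK mulrC; by case: (vP n).
have := uv n; lra.
Qed.

(** * The A-adjoint *)

Section Sharp.
Context {A T : H -> H} (HA : positive_operator dot A) (HT : in_BA dot A T).

Lemma semi_innerA : semi_inner (innerA dot A).
Proof.
case: HA => -[Al _] Asym Apos; split=> // [a x y z|x y].
  by rewrite /innerA Al linearPl.
by rewrite /innerA Asym (siC SD).
Qed.

Lemma subspace_range : subspace (range A).
Proof.
case: HA => -[Al _] _ _; split=> [|a _ _ [x _ <-] [y _ <-]].
  by exists 0; rewrite ?(linmap0 Al).
by exists (a *: x + y); rewrite ?Al.
Qed.

Lemma ker_orth_range x : (forall m, range A m -> dot x m = 0) -> A x = 0.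
Proof.
case: HA => _ Asym _ x0; apply: dot_nondegenerate => y.
rewrite (si0r SD) -Asym (siC SD).
by rewrite x0 ?conjC0//; exists y.
Qed.

(** Since [A] is self-adjoint, [p] is orthogonal to the range of [A], and [closure_norm_le] applies
    with constant 0. *)
Lemma closure_range_ker0 p : closure (range A) p -> A p = 0 -> p = 0.
Proof.
case: HA => _ Asym _ cp Ap0; apply: snorm_eq0; apply/eqP.
rewrite eq_le snorm_ge0 andbT.
apply: closure_norm_le cp _ => // _ [y _ <-].
by rewrite -Asym Ap0 (si0l SD) normr0 mul0r.
Qed.

Lemma closure_range_decomp x :
  exists2 p, closure (range A) p & A (x - p) = 0.
Proof.
have [p cp px] := projection _ x subspace_range.
by exists p => //; exact: ker_orth_range.
Qed.

Lemma sharpAP : [/\ bounded_operator (sharpA dot A T),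
  A \o sharpA dot A T = adjoint dot T \o A &
  range (sharpA dot A T) `<=` closure (range A)].
Proof.
apply: (getPex (P := [set X | [/\ bounded_operator X,
  A \o X = adjoint dot T \o A & range X `<=` closure (range A)]])).
case: HT => HbT rT; have [HbS TS] := adjointP T HbT.
have [Sl _] := (bounded_operatorP (adjoint dot T)).1 HbS.
case: (HA) => HbA Asym _; have [Al _] := (bounded_operatorP A).1 HbA.
set S := adjoint dot T in rT TS HbS Sl *.
have ex x : exists p, closure (range A) p /\ A p = S (A x).
  have [y _ yx] : range A (S (A x)) by apply: rT; exists x.
  have [p cp yp] := closure_range_decomp y; exists p; split => //.
  by apply/eqP; rewrite -yx eq_sym -subr_eq0 -(linmapB Al) yp.
have [X XP] := choice ex.
have Xc x : closure (range A) (X x) by case: (XP x).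
have AX x : A (X x) = S (A x) by case: (XP x).
have [sc0 sc] := closure_subspace _ subspace_range.
exists X; split; last by move=> _ [x _ <-].
- apply/bounded_operatorP; split=> [a x y|].
    (* The pointwise choice is linear because [A] is injective on the closure of its range. *)
    apply/eqP; rewrite -subr_eq0; apply/eqP/closure_range_ker0.
      rewrite addrC -scaleN1r; apply: (sc) => //; exact: sc.
    by rewrite (linmapB Al) Al !AX Al Sl subrr.
  have dXA x u : dot (X x) (A u) = dot x (A (T u)).
    by rewrite -Asym AX (siC SD) -TS -(siC SD) Asym.
  have [|C VC] :=
    uniform_boundedness [set A (T u) | u in [set u | nr (A u) <= 1]].
    move=> x; exists (nr (X x)) => _ [u /= u1 <-]; rewrite -dXA.
    apply: le_trans (modC_dot_le _ _) _.
    by rewrite ler_piMr// snorm_ge0.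
  exists (`|C| + 1) => [|x]; first by rewrite ltr_wpDl.
  apply: closure_norm_le (Xc x) _.
    by rewrite mulr_ge0 ?addr_ge0 ?snorm_ge0.
  move=> _ [u _ <-].
  have [u0|uN0] := eqVneq (nr (A u)) 0.
    by rewrite (snorm_eq0 _ u0) (si0r SD) normr0 (snorm0 SD) mulr0.
  have u0 : 0 < nr (A u) by rewrite lt_def uN0 snorm_ge0.
  have [Tl _] := (bounded_operatorP T).1 HbT.
  (* Rescaling [u] to [|A u| = 1] turns the uniform bound into [|A T u| <= C |A u|]. *)
  have : nr (A (T ((nr (A u))^-1%:C *: u))) <= C.
    apply: VC; exists ((nr (A u))^-1%:C *: u) => //=.
    by rewrite (linmapZ Al) (snormZ SD) modC_real gtr0_norm ?invr_gt0// mulVf.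
  rewrite (linmapZ Tl) (linmapZ Al) (snormZ SD) modC_real.
  rewrite [`|_^-1|]gtr0_norm ?invr_gt0// ler_pdivrMl//.
  move=> h; rewrite dXA; apply: le_trans (modC_dot_le _ _) _.
  rewrite [leRHS]mulrAC [leRHS]mulrC ler_wpM2l ?snorm_ge0//.
  apply: le_trans h _; rewrite mulrC ler_wpM2r ?snorm_ge0//.
  by rewrite (le_trans (ler_norm _))// lerDl.
- by apply/funext => x /=; rewrite AX.
Qed.


Local Notation SA := semi_innerA.
Local Notation X := (sharpA dot A T).
Local Notation N := (normA dot A).

Lemma sharpA_innerA x y : innerA dot A (T x) y = innerA dot A x (X y).
Proof.
case: HT => HbT _; have [_ TS] := adjointP T HbT.
case: HA => _ Asym _; have [_ AX _] := sharpAP.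
rewrite /innerA Asym TS Asym; congr (dot _ _).
by have := congr1 (fun f => f y) AX.
Qed.

Lemma sharpA_innerAC x y : innerA dot A (X x) y = innerA dot A x (T y).
Proof. by rewrite (siC SA) -sharpA_innerA -(siC SA). Qed.

(** * The A-operator seminorm *)

(** This carries the growth of [|S^n x|] over to the A-seminorm, as [snorm_sadj_le] requires. *)
Lemma normA_le_norm : exists K : R, forall x, N x <= K * nr x.
Proof.
case: HA => /bounded_operatorP[_ [c c0 Ac]] _ _.
exists (Num.sqrt c) => x.
rewrite -[leRHS]ger0_norm ?mulr_ge0 ?snorm_ge0 ?sqrtr_ge0// -sqrtr_sqr.
apply: ler_wsqrtr; rewrite exprMn sqr_sqrtr ?(ltW c0) // expr2 mulrA.
apply: le_trans (modC_ge_Re _) _; apply: le_trans (modC_dot_le _ _) _.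
by apply: ler_wpM2r; rewrite ?snorm_ge0.
Qed.

Lemma sadj_A_bounded (S : H -> H) : bounded_operator S ->
  (forall x y, innerA dot A (S x) y = innerA dot A x (S y)) ->
  exists2 c : R, 0 <= c & forall x, N (S x) <= c * N x.
Proof.
move=> /bounded_operatorP[_ [c c0 Sc]] Ssym.
have [K NK] := normA_le_norm.
exists c; first exact: ltW.
apply: (snorm_sadj_le SA S (fun x => `|K| * nr x) c c0 Ssym) => x n.
apply: le_trans (NK _) _; apply: (@le_trans _ _ (`|K| * nr (iter n S x))).
  by apply: ler_wpM2r; [exact: snorm_ge0|exact: ler_norm].
rewrite -mulrA; apply: ler_wpM2l => //.
elim: n => [|n ih]; first by rewrite mulr1.
rewrite iterS; apply: le_trans (Sc _) _.
by rewrite exprS mulrCA ler_pM2l.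
Qed.

Lemma bounded_operator_comp (S1 S2 : H -> H) :
  bounded_operator S1 -> bounded_operator S2 -> bounded_operator (S1 \o S2).
Proof.
move=> /bounded_operatorP[l1 [c1 c10 b1]] /bounded_operatorP[l2 [c2 c20 b2]].
apply/bounded_operatorP; split=> [a x y|]; first by rewrite /= l2 l1.
exists (c1 * c2) => [|x]; first exact: mulr_gt0.
by rewrite /= -mulrA; apply: le_trans (b1 _) _; rewrite ler_pM2l.
Qed.

Lemma opnormA_le (P : H -> H) c : 0 <= c -> (forall x, N (P x) <= c * N x) ->
  opnormA dot A P <= c.
Proof.
move=> c0 Pc; apply: sup_le_ge0 => // _ [x _ <-].
(* A quotient with denominator 0 has value 0. *)
have [->|xN0] := eqVneq (N x) 0; first by rewrite invr0 mulr0.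
have x0 : 0 < N x by rewrite lt_def xN0; exact: snorm_ge0.
by rewrite ler_pdivrMr.
Qed.

Lemma opnormA_ge0 (P : H -> H) : 0 <= opnormA dot A P.
Proof. by apply: sup_ge0 => _ [x _ <-]; apply: divr_ge0; exact: sqrtr_ge0. Qed.

Lemma normA_closure_range x : exists2 p, closure (range A) p & N (x - p) = 0.
Proof.
have [p cp px] := closure_range_decomp x; exists p => //.
by rewrite /normA /innerA px (si0l SD) sqrtr0.
Qed.

Lemma normA_eq_sub0 x p : N (x - p) = 0 -> N x = N p.
Proof.
move=> xp; apply/eqP; rewrite eq_le; apply/andP; split.
  by have := snormD SA (x - p) p; rewrite subrK [snorm _ (x - p)]xp add0r.
have := snormD SA (p - x) x; rewrite subrK -opprB (snormN SA).
by rewrite [snorm _ (x - p)]xp add0r.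
Qed.

(** The supremum runs over the closure of the range of [A] only. Every [x] differs from a point [p]
    there by an A-null vector, which [P] keeps A-null by the bound [c]; that bound also makes the
    supremum finite. *)
Lemma normA_opnormA (P : H -> H) c :
  (forall (a : R[i]) x y, P (a *: x + y) = a *: P x + P y) ->
  (forall x, N (P x) <= c * N x) ->
  forall x, N (P x) <= opnormA dot A P * N x.
Proof.
move=> Pl Pc x; have [p cp xp] := normA_closure_range x.
have -> : N (P x) = N (P p).
  apply: normA_eq_sub0; rewrite -(linmapB Pl); apply/eqP.
  rewrite eq_le; apply/andP; split; last exact: snorm_ge0.
  by have := Pc (x - p); rewrite xp mulr0.
rewrite (normA_eq_sub0 _ _ xp).
have [p0|pN0] := eqVneq (N p) 0; first by have := Pc p; rewrite p0 !mulr0.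
have p0 : 0 < N p by rewrite lt_def pN0; exact: snorm_ge0.
rewrite -ler_pdivrMr//; apply: ub_le_sup.
  exists `|c| => _ [y _ <-].
  have [->|yN0] := eqVneq (N y) 0; first by rewrite invr0 mulr0.
  have y0 : 0 < N y by rewrite lt_def yN0; exact: snorm_ge0.
  rewrite ler_pdivrMr//; apply: le_trans (Pc y) _.
  by apply: ler_wpM2r; [exact: ltW|exact: ler_norm].
exists p => //; split => // p00; move: pN0.
by rewrite p00 [N 0](snorm0 SA) eqxx.
Qed.

(** * Combinations of [X T] and [T X] with weights [a] and [1 - a] *)

Definition combA (a : R) x : H := a%:C *: X (T x) + (1 - a)%:C *: T (X x).

Lemma T_linear (a : R[i]) x y : T (a *: x + y) = a *: T x + T y.
Proof. by case: HT => /bounded_operatorP[]. Qed.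

Lemma sharpA_linear (a : R[i]) x y : X (a *: x + y) = a *: X x + X y.
Proof. by case: sharpAP => /bounded_operatorP[]. Qed.

Lemma combA_linear (b : R) (a : R[i]) x y :
  combA b (a *: x + y) = a *: combA b x + combA b y.
Proof.
rewrite /combA T_linear !sharpA_linear T_linear !scalerDr !scalerA.
by rewrite addrACA ![a * _]mulrC.
Qed.

(** Both products are self-adjoint for the A-form, so [sadj_A_bounded] applies to each; the sum of
    the two constants serves both. *)
Lemma combA_A_bounded : exists2 c : R, 0 <= c &
  (forall x, N (X (T x)) <= c * N x) /\ (forall x, N (T (X x)) <= c * N x).
Proof.
have [bX _ _] := sharpAP; have [bT _] := HT.
have [|c1 c10 h1] := sadj_A_bounded (X \o T) (bounded_operator_comp _ _ bX bT).
  by move=> x y; rewrite /= sharpA_innerAC sharpA_innerA.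
have [|c2 c20 h2] := sadj_A_bounded (T \o X) (bounded_operator_comp _ _ bT bX).
  by move=> x y; rewrite /= sharpA_innerA sharpA_innerAC.
exists (c1 + c2); first exact: addr_ge0.
split=> x; [apply: le_trans (h1 x) _|apply: le_trans (h2 x) _];
  by apply: ler_wpM2r; rewrite ?lerDl ?lerDr//; exact: snorm_ge0.
Qed.

Lemma normAZ (a : R) x : N (a%:C *: x) = `|a| * N x.
Proof. by have := snormZ SA a%:C x; rewrite modC_real. Qed.

Lemma combA_opnormA (a : R) x :
  N (combA a x) <= opnormA dot A (combA a) * N x.
Proof.
have [c c0 [c1 c2]] := combA_A_bounded.
apply: (normA_opnormA (combA a) ((`|a| + `|1 - a|) * c)).
  exact: combA_linear.
move=> y; apply: le_trans (snormD SA _ _) _.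
rewrite -mulrA mulrDl; apply: lerD;
  by rewrite [snorm _ _]normAZ; apply: ler_wpM2l.
Qed.

Lemma opnormA_combA_lip : exists2 c : R, 0 <= c &
  forall a b : R, opnormA dot A (combA a) <=
                  opnormA dot A (combA b) + `|a - b| * c.
Proof.
have [c c0 [c1 c2]] := combA_A_bounded.
exists (c + c); first exact: addr_ge0.
move=> a b; apply: opnormA_le.
  by rewrite addr_ge0 ?opnormA_ge0// mulr_ge0// addr_ge0.
move=> x.
(* [combA] is affine in its weight, and the slope [X T - T X] is A-bounded by [c + c]. *)
have -> : combA a x = combA b x + (a - b)%:C *: (X (T x) - T (X x)).
  rewrite /combA scalerBr addrACA -scaleNr -!scalerDl -!rmorphN -!rmorphD.
  by congr (_%:C *: _ + _%:C *: _); ring.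
apply: le_trans (snormD SA _ _) _; rewrite mulrDl; apply: lerD.
  exact: combA_opnormA.
rewrite [snorm _ _]normAZ -mulrA; apply: ler_wpM2l => //.
apply: le_trans (snormD SA _ _) _; rewrite (snormN SA) mulrDl.
by apply: lerD; [exact: c1|exact: c2].
Qed.

Lemma opnormA_combA_min : exists m : R,
  is_minimum [set opnormA dot A (combA a) | a in [set a : R | 0 <= a <= 1]] m.
Proof.
have [c c0 lip] := opnormA_combA_lip.
have cont : continuous (fun a : R => opnormA dot A (combA a)).
  move=> a; apply/cvgrPdist_le => /= e e0.
  (* The Lipschitz constant may be 0, so the tolerance is divided by [c + 1]. *)
  have c1 : 0 < c + 1 by rewrite ltr_wpDl.
  near=> b.
  have ab : `|a - b| * c <= e.
    apply: (@le_trans _ _ (`|a - b| * (c + 1))).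
      by apply: ler_wpM2l => //; rewrite lerDl.
    rewrite -ler_pdivlMr//; near: b.
    by apply: cvgr_dist_le => //; rewrite divr_gt0.
  rewrite ler_distl; have := lip a b; have := lip b a.
  rewrite [`|b - a|]distrC; lra.
have [m] := EVT_min ler01 (continuous_subspaceT cont).
rewrite in_itv => m01 mmin.
exists (opnormA dot A (combA m)); split; first by exists m.
by move=> _ [a /= a01 <-]; apply: mmin; rewrite in_itv.
Unshelve. all: by end_near.
Qed.

(** * Pointwise estimates and the two inequalities *)

Lemma combA_quadratic_le (a : R) x : N x = 1 ->
  a * N (T x) ^+ 2 + (1 - a) * N (X x) ^+ 2 <= opnormA dot A (combA a).
Proof.
move=> x1; have := combA_opnormA a x; rewrite x1 mulr1; apply: le_trans.
have := si_CauchySchwarz SA (combA a x) x; rewrite [snorm _ x]x1 mulr1.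
apply: le_trans; apply: le_trans (modC_ge_Re _).
(* The left side is the real part of [<combA a x, x>_A], since [<X T x, x>_A = |T x|_A^2] and
   [<T X x, x>_A = |X x|_A^2]. *)
rewrite (siDl SA) !(siZl SA) ReD !ReRM sharpA_innerAC (sharpA_innerA (X x)).
by rewrite -!(sqr_snorm SA).
Qed.

Lemma modC_innerA_le x : N x = 1 ->
  modC (innerA dot A (T x) x) <= N (T x) /\
  modC (innerA dot A (T x) x) <= N (X x).
Proof.
move=> x1; split.
  by have := si_CauchySchwarz SA (T x) x; rewrite [snorm _ x]x1 mulr1.
have := si_CauchySchwarz SA x (X x); rewrite [snorm _ x]x1 mul1r.
by rewrite -sharpA_innerA.
Qed.

Lemma sqr_modC_innerA_le x : N x = 1 ->
  modC (innerA dot A (T x) x) ^+ 2 <= N (T x) ^+ 2 /\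
  modC (innerA dot A (T x) x) ^+ 2 <= N (X x) ^+ 2.
Proof.
move=> /modC_innerA_le[h1 h2].
by split; rewrite ler_pXn2r// nnegrE ?modC_ge0// sqrtr_ge0.
Qed.

Lemma sqr_normAalpha_le (a : R) : 0 <= a <= 1 ->
  normAalpha dot A a T ^+ 2 <= opnormA dot A (combA (1 - a)).
Proof.
move=> /andP[a0 a1]; apply: sqr_sup_le; first exact: opnormA_ge0.
  by move=> _ [x _ <-]; exact: sqrtr_ge0.
move=> _ [x /= x1 <-].
have [_ h] := sqr_modC_innerA_le x x1.
rewrite sqr_sqrtr; last first.
  by rewrite addr_ge0// mulr_ge0 ?subr_ge0// exprn_ge0 ?modC_ge0 ?sqrtr_ge0.
(* Only the inner-product term is enlarged, to [a * N (X x) ^+ 2]; the term in [N (T x)] is already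
   the right one. *)
apply: le_trans (combA_quadratic_le (1 - a) x x1).
rewrite opprB addrCA subrr addr0 addrC lerD2l.
exact: ler_wpM2l.
Qed.

Lemma sqr_numradA_le (a : R) : 0 <= a <= 1 ->
  numradA dot A T ^+ 2 <= opnormA dot A (combA a).
Proof.
move=> /andP[a0 a1]; apply: sqr_sup_le; first exact: opnormA_ge0.
  by move=> _ [x _ <-]; exact: modC_ge0.
move=> _ [x /= x1 <-].
have [h1 h2] := sqr_modC_innerA_le x x1.
apply: le_trans (combA_quadratic_le a x x1).
(* [|<T x, x>_A|^2] is split with weights [a] and [1 - a], and each share gets its own bound. *)
have := ler_wpM2l a0 h1; rewrite -subr_ge0 in a1.
by have := ler_wpM2l a1 h2 => /=; lra.
Qed.

End Sharp.
End Hilbert.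

Theorem theorem2p13 (R : realType) (H : completeNormedModType R[i])
    (dot : {dot H for Num.conj}) (Hdot : is_inner dot)
    (A : H -> H) (HA : positive_operator dot A)
    (T : H -> H) (HT : in_BA dot A T) :
  (forall a : R, 0 <= a <= 1 ->
     normAalpha dot A a T ^+ 2 <=
     opnormA dot A (fun x =>
       (1 - a)%:C *: sharpA dot A T (T x) + a%:C *: T (sharpA dot A T x)))
  /\
  (exists m : R,
     is_minimum
       [set opnormA dot A (fun x =>
          a%:C *: sharpA dot A T (T x) + (1 - a)%:C *: T (sharpA dot A T x))
       | a in [set a : R | 0 <= a <= 1]] m
     /\ numradA dot A T ^+ 2 <= m).
Proof.
split=> [a a01|].
  have := sqr_normAalpha_le Hdot HA HT a a01.
  by rewrite /combA subKr.
have [m mmin] := opnormA_combA_min Hdot HA HT; exists m; split=> //.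
(* The minimum is the value at some [a] in [0,1], where the inequality for a single weight
   applies. *)
have [[a a01 <-] _] := mmin.
exact: (sqr_numradA_le Hdot HA HT a a01).
Qed.
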